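(* Fix $0<c_{\min}\le c_{\max}<\infty$. For every $q\in(-1,1)$ there is a constant $\alpha=\alpha(q)>1$ (possibly depending on the fixed bounds $c_{\min},c_{\max}$) such that for all $n\in\mathbb N$, all $0=x_0<x_1<\dots<x_{n+1}=1$, all $c_1,c_2\in[c_{\min},c_{\max}]$ with $\frac{c_2-c_1}{c_2+c_1}=q$, and all frequencies $\omega\ge\omega_0>0$, the sequence $\beta_{0,\ell}$ satisfies $$|\beta_{0,\ell}|\le\alpha^{\omega}\quad\text{and}\quad|\beta_{0,\ell}|\ge\alpha^{-\omega}\qquad\text{for all }0\le\ell\le n.$$
   Context: The wave speed takes the values $c_j=c_1$ for odd $j$ and $c_j=c_2$ for even $j$, $1\le j\le n+1$, on the intervals $(x_{j-1},x_j)$. With $h_\ell=x_\ell-x_{\ell-1}$ and $q_\ell:=\frac{c_{\ell+1}-c_\ell}{c_{\ell+1}+c_\ell}=(-1)^{\ell+1}q$, the complex sequence $(\beta_{0,\ell})_{\ell=0}^n$ is defined by $\beta_{0,0}=1$ and $$\beta_{0,\ell}=\frac1{1+q_\ell}\left(e^{-\mathrm i\omega h_\ell/c_\ell}\beta_{0,\ell-1}+q_\ell\,\overline{e^{-\mathrm i\omega h_\ell/c_\ell}\beta_{0,\ell-1}}\right),\qquad1\le\ell\le n.$$ *)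

(* Defs.v *)
(* Stdlib reals with Coquelicot's complex numbers. *)
From Stdlib Require Import Reals.
From Coquelicot Require Import Coquelicot.
Open Scope R_scope.

Definition Cexp (z : C) : C := (exp (Re z) * cos (Im z), exp (Re z) * sin (Im z)).

Definition wave_speed (c1 c2 : R) (j : nat) : R := if Nat.odd j then c1 else c2.

Definition mesh_width (x : nat -> R) (l : nat) : R := x l - x (pred l).

(* For [c = wave_speed c1 c2] this is [(-1) ^ (l + 1) * ((c2 - c1) / (c2 + c1))]. *)
Definition jump (c : nat -> R) (l : nat) : R := (c (S l) - c l) / (c (S l) + c l).

(* A grid x_0 < ... < x_{n+1} of [0, 1] is given by [x : nat -> R]; values of [x]
   beyond index n + 1 are irrelevant. *)
Definition is_grid (n : nat) (x : nat -> R) : Prop :=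
  x 0%nat = 0 /\ x (S n) = 1 /\ (forall j : nat, (j <= n)%nat -> x j < x (S j)).

Fixpoint beta0 (c x : nat -> R) (omega : R) (l : nat) : C :=
  match l with
  | O => RtoC 1
  | S k =>
      let z := (Cexp (- (Ci * RtoC (omega * mesh_width x l / c l)))
                * beta0 c x omega k)%C in
      (/ (1 + RtoC (jump c l)) * (z + RtoC (jump c l) * Cconj z))%C
  end.

(* Main.v *)
(** In the real coordinates [(Re, Im)] one step of the recursion is a rotation by
    [- omega * h / c] followed by [diag (1, r ^ (+-1))], [r = (1 - q) / (1 + q)], with
    alternating exponents.  A diagonal map turns the quadratic form [a^2 + p b^2] into
    another one of the same family, and over two consecutive steps the weight [p] returns
    to its value, so only the forms with [p = 1, r^2, r^(-2)] occur.  A rotation by [t]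
    changes such a form at most by the factor [exp (K |t|)], whence a bound by the
    exponential of the total angle, which is at most [omega / cmin].  There is no loss at
    the ends because [beta0] starts at [(1, 0)], where all the forms take the value 1. *)
Require Import Defs.
From Stdlib Require Import Reals Lra Lia.
From Coquelicot Require Import Coquelicot.
Open Scope R_scope.

Definition wnorm2 (p : R) (z : C) : R := Re z ^ 2 + p * Im z ^ 2.

Lemma exp_le (s t : R) : s <= t -> exp s <= exp t.
Proof. intros [h| ->]; [left; now apply exp_increasing | apply Rle_refl]. Qed.

Lemma Rabs_sin_le (t : R) : Rabs (sin t) <= Rabs t.
Proof.
  assert (pos : forall u, 0 <= u -> Rabs (sin u) <= u).
  { intros u hu. destruct (Req_dec u 0) as [->|hu0].
    - rewrite sin_0, Rabs_R0. lra.
    - assert (sin u < u) by (apply sin_lt_x; lra).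
      (* Up to 3, which is below pi, the sine is nonnegative; beyond 3 the bound 1 on the sine
         suffices. *)
      destruct (Rle_dec u 3).
      + assert (0 <= sin u).
        { apply sin_ge_0; [lra|]. pose proof PI2_3_2. lra. }
        rewrite Rabs_pos_eq; lra.
      + pose proof (SIN_bound u). apply Rabs_le. lra. }
  destruct (Rle_dec 0 t).
  - rewrite (Rabs_pos_eq t) by lra. now apply pos.
  - rewrite <- (Rabs_Ropp t), <- (Rabs_Ropp (sin t)), <- sin_neg, (Rabs_pos_eq (- t)) by lra.
    apply pos; lra.
Qed.

Definition clockwise (t : R) : C := (cos t, - sin t).

Lemma Cexp_opp_Ci (t : R) : Cexp (- (Ci * RtoC t)) = clockwise t.
Proof.
  unfold clockwise, Cexp, Ci, RtoC; simpl.
  replace (- (0 * t - 1 * 0)) with 0 by ring.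
  replace (- (0 * 0 + 1 * t)) with (- t) by ring.
  rewrite exp_0, cos_neg, sin_neg. f_equal; ring.
Qed.

(** The rotation adds [(1 - p) * sin t * B] to the form, with [B] at most [a ^ 2 + b ^ 2] in
    modulus. The two hypotheses, applied to [a ^ 2] and [b ^ 2] separately, turn this into a
    relative change of at most [K * Rabs t], and [1 + u <= exp u]. *)
Lemma wnorm2_rotation_le (p K t : R) (z : C) :
  Rabs (1 - p) <= K -> Rabs (1 - p) <= K * p ->
  wnorm2 p (clockwise t * z)%C <= exp (K * Rabs t) * wnorm2 p z.
Proof.
  intros h1 h2. destruct z as [a b]. unfold wnorm2, clockwise, Re, Im; cbn [fst snd Cmult].
  pose proof (sin2_cos2 t) as hcs. unfold Rsqr in hcs.
  pose proof (Rabs_sin_le t) as hs.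
  set (s := sin t) in *. set (c := cos t) in *.
  set (B := s * (b ^ 2 - a ^ 2) + 2 * (a * b * c)).
  (* Cauchy-Schwarz: [(b^2 - a^2)^2 + (2 a b)^2 = (a^2 + b^2)^2] *)
  assert (hB : Rabs B <= a ^ 2 + b ^ 2).
  { rewrite <- (Rabs_pos_eq (a ^ 2 + b ^ 2)) by nra.
    apply Rsqr_le_abs_0. unfold Rsqr.
    assert ((a ^ 2 + b ^ 2) * (a ^ 2 + b ^ 2) - B * B
            = (c * (b ^ 2 - a ^ 2) - s * (2 * (a * b))) ^ 2
              + (1 - (s * s + c * c)) * (a ^ 2 + b ^ 2) ^ 2) by (unfold B; ring).
    rewrite hcs, Rminus_diag, Rmult_0_l, Rplus_0_r in H.
    pose proof (pow2_ge_0 (c * (b ^ 2 - a ^ 2) - s * (2 * (a * b)))). lra. }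
  pose proof (pow2_ge_0 a) as ha. pose proof (pow2_ge_0 b) as hb.
  assert (hQ : Rabs (1 - p) * (a ^ 2 + b ^ 2) <= K * (a ^ 2 + p * b ^ 2)).
  { pose proof (Rmult_le_compat_r _ _ _ ha h1). pose proof (Rmult_le_compat_r _ _ _ hb h2).
    lra. }
  assert (hid : (c * a - - s * b) ^ 2 + p * (c * b + - s * a) ^ 2
          = (a ^ 2 + p * b ^ 2) + (1 - p) * s * B).
  { transitivity ((s * s + c * c) * (a ^ 2 + p * b ^ 2) + (1 - p) * s * B);
      [unfold B; ring | rewrite hcs; ring]. }
  assert (habs : (1 - p) * s * B <= Rabs t * (K * (a ^ 2 + p * b ^ 2))).
  { eapply Rle_trans; [apply Rle_abs|]. rewrite !Rabs_mult.
    replace (Rabs (1 - p) * Rabs s * Rabs B) with (Rabs s * (Rabs (1 - p) * Rabs B)) by ring.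
    apply Rmult_le_compat; auto using Rabs_pos.
    - apply Rmult_le_pos; apply Rabs_pos.
    - eapply Rle_trans; [|exact hQ].
      apply Rmult_le_compat_l; [apply Rabs_pos|exact hB]. }
  (* A negative [p] would give [K >= 1 - p > 0], hence [K * p < 0], against the second
     hypothesis. *)
  assert (hp : 0 <= p).
  { destruct (Rle_dec 0 p) as [|n]; [assumption|].
    pose proof (Rabs_pos (1 - p)). pose proof (Rle_abs (1 - p)). nra. }
  pose proof (exp_ineq1_le (K * Rabs t)) as he.
  assert (0 <= a ^ 2 + p * b ^ 2) by nra.
  rewrite hid.
  apply Rle_trans with ((1 + K * Rabs t) * (a ^ 2 + p * b ^ 2)); [lra|].
  now apply Rmult_le_compat_r.
Qed.

(** The upper bound applied to the inverse rotation, by [- t]. *)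
Lemma wnorm2_rotation_ge (p K t : R) (z : C) :
  Rabs (1 - p) <= K -> Rabs (1 - p) <= K * p ->
  exp (- (K * Rabs t)) * wnorm2 p z <= wnorm2 p (clockwise t * z)%C.
Proof.
  intros h1 h2.
  pose proof (wnorm2_rotation_le p K (- t) (clockwise t * z)%C h1 h2) as h.
  rewrite Rabs_Ropp in h.
  replace (clockwise (- t) * (clockwise t * z))%C with z in h.
  - apply Rmult_le_reg_l with (exp (K * Rabs t)); [apply exp_pos|].
    rewrite <- Rmult_assoc, <- exp_plus, Rplus_opp_r, exp_0, Rmult_1_l. exact h.
  - destruct z as [a b]. pose proof (sin2_cos2 t) as hcs. unfold Rsqr in hcs.
    unfold clockwise. rewrite cos_neg, sin_neg.
    apply injective_projections; simpl.
    + transitivity ((sin t * sin t + cos t * cos t) * a); [rewrite hcs|]; ring.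
    + transitivity ((sin t * sin t + cos t * cos t) * b); [rewrite hcs|]; ring.
Qed.

Lemma wnorm2_transmission (p q : R) (w : C) : 1 + q <> 0 ->
  wnorm2 p (/ (1 + RtoC q) * (w + RtoC q * Cconj w))%C
  = wnorm2 (p * ((1 - q) / (1 + q)) ^ 2) w.
Proof.
  intros hq.
  replace (1 + RtoC q)%C with (RtoC (1 + q)) by (rewrite RtoC_plus; reflexivity).
  rewrite <- RtoC_inv by exact hq.
  destruct w as [a b]. unfold wnorm2, Cconj; simpl. field. exact hq.
Qed.

Lemma jump_wave_speed (c1 c2 : R) (l : nat) :
  jump (wave_speed c1 c2) l
  = if Nat.odd l then (c2 - c1) / (c2 + c1) else - ((c2 - c1) / (c2 + c1)).
Proof.
  unfold jump, wave_speed. rewrite Nat.odd_succ, <- Nat.negb_odd.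
  destruct (Nat.odd l); simpl; [reflexivity|].
  rewrite (Rplus_comm c1 c2). unfold Rdiv. ring.
Qed.

(* The weight [p] for which step [l] of the recursion turns [wnorm2 1] into [wnorm2 p]. *)
Definition step_weight (q : R) (l : nat) : R :=
  if Nat.odd l then ((1 - q) / (1 + q)) ^ 2 else ((1 + q) / (1 - q)) ^ 2.

(** A single [K] for the rotation bounds at both step weights: these are inverse to each other, so
    [K] times either of them still contains the term 1. *)
Definition weight_rate (q : R) : R :=
  2 + ((1 - q) / (1 + q)) ^ 2 + ((1 + q) / (1 - q)) ^ 2.

Lemma weight_rate_ge2 (q : R) : 2 <= weight_rate q.
Proof.
  unfold weight_rate.
  pose proof (pow2_ge_0 ((1 - q) / (1 + q))).
  pose proof (pow2_ge_0 ((1 + q) / (1 - q))). lra.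
Qed.

Lemma step_weight_rate (q : R) (l : nat) : -1 < q < 1 ->
  Rabs (1 - step_weight q l) <= weight_rate q /\
  Rabs (1 - step_weight q l) <= weight_rate q * step_weight q l.
Proof.
  intros hq. unfold step_weight, weight_rate.
  set (u := ((1 - q) / (1 + q)) ^ 2). set (v := ((1 + q) / (1 - q)) ^ 2).
  assert (huv : u * v = 1) by (unfold u, v; field; lra).
  assert (0 <= u) by apply pow2_ge_0. assert (0 <= v) by apply pow2_ge_0.
  destruct (Nat.odd l); split; apply Rabs_le; nra.
Qed.

Lemma step_weight_mul (q : R) (l : nat) : -1 < q < 1 ->
  step_weight q (S l) * step_weight q l = 1.
Proof.
  intros hq. unfold step_weight. rewrite Nat.odd_succ, <- Nat.negb_odd.
  destruct (Nat.odd l); simpl; field; lra.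
Qed.

Lemma wnorm2_beta0_step (c1 c2 : R) (x : nat -> R) (omega p : R) (l : nat) :
  -1 < (c2 - c1) / (c2 + c1) < 1 ->
  wnorm2 p (beta0 (wave_speed c1 c2) x omega (S l))
  = let t := omega * mesh_width x (S l) / wave_speed c1 c2 (S l) in
    wnorm2 (p * step_weight ((c2 - c1) / (c2 + c1)) (S l))
      (clockwise t * beta0 (wave_speed c1 c2) x omega l)%C.
Proof.
  intros hq. cbn [beta0]. cbv zeta. rewrite jump_wave_speed, Cexp_opp_Ci.
  set (q := (c2 - c1) / (c2 + c1)) in *.
  unfold step_weight. destruct (Nat.odd (S l)); rewrite wnorm2_transmission by lra;
    [reflexivity|].
  (* At an even index the jump is [- q], which inverts the ratio. *)
  do 2 f_equal; f_equal; f_equal; ring.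
Qed.

(** Exponents of successive rotations add up; [T'] leaves room for replacing the local wave speed by
    [cmin]. *)
Lemma wnorm2_rotation_bounds (p K t T T' : R) (z : C) :
  Rabs (1 - p) <= K -> Rabs (1 - p) <= K * p -> K * Rabs t + T <= T' ->
  exp (- T) <= wnorm2 p z <= exp T ->
  exp (- T') <= wnorm2 p (clockwise t * z)%C <= exp T'.
Proof.
  intros h1 h2 hT [hl hu]. split.
  - eapply Rle_trans; [|apply (wnorm2_rotation_ge p K t z h1 h2)].
    eapply Rle_trans; [|apply Rmult_le_compat_l; [left; apply exp_pos|exact hl]].
    rewrite <- exp_plus. apply exp_le. lra.
  - eapply Rle_trans; [apply (wnorm2_rotation_le p K t z h1 h2)|].
    eapply Rle_trans; [apply Rmult_le_compat_l; [left; apply exp_pos|exact hu]|].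
    rewrite <- exp_plus. apply exp_le. lra.
Qed.

(* Both weights are needed: the step to [S l] carries [wnorm2 1] back to weight
   [step_weight q (S l)], and weight [step_weight q (S (S l))] back to [wnorm2 1]. *)
Lemma wnorm2_beta0_bounds (n : nat) (x : nat -> R) (cmin c1 c2 omega : R) :
  is_grid n x -> 0 < cmin -> cmin <= c1 -> cmin <= c2 -> 0 <= omega ->
  let q := (c2 - c1) / (c2 + c1) in -1 < q < 1 ->
  forall l : nat, (l <= n)%nat ->
    let T := weight_rate q * (omega * x l / cmin) in
    let b := beta0 (wave_speed c1 c2) x omega l in
    exp (- T) <= wnorm2 1 b <= exp T /\
    exp (- T) <= wnorm2 (step_weight q (S l)) b <= exp T.
Proof.
  intros [hx0 [_ hx]] hc0 hc1 hc2 hom q hq. pose proof (weight_rate_ge2 q) as hK.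
  induction l as [|l IH]; intros hl T b.
  - assert (hb : forall p, wnorm2 p b = 1)
      by (intros p; unfold b, wnorm2; simpl; ring).
    assert (hT : T = 0) by (unfold T; rewrite hx0; unfold Rdiv; ring).
    rewrite !hb, hT, Ropp_0, exp_0. lra.
  - destruct (IH ltac:(lia)) as [IH1 IHp]. unfold b.
    rewrite !wnorm2_beta0_step by exact hq. cbv zeta. fold q.
    rewrite Rmult_1_l, step_weight_mul by exact hq.
    set (t := omega * mesh_width x (S l) / wave_speed c1 c2 (S l)).
    (* The angle grows when the speed is lowered to [cmin], and then the mesh widths telescope to
       [x (S l)]. *)
    assert (hT : weight_rate q * Rabs t + weight_rate q * (omega * x l / cmin) <= T).
    { unfold T. rewrite <- Rmult_plus_distr_l. apply Rmult_le_compat_l; [lra|].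
      assert (hm : 0 < mesh_width x (S l))
        by (unfold mesh_width; simpl; specialize (hx l ltac:(lia)); lra).
      assert (hc : cmin <= wave_speed c1 c2 (S l))
        by (unfold wave_speed; destruct (Nat.odd (S l)); assumption).
      replace (omega * x (S l) / cmin)
        with (omega * mesh_width x (S l) / cmin + omega * x l / cmin)
        by (unfold mesh_width; simpl; field; lra).
      apply Rplus_le_compat_r. unfold t.
      rewrite Rabs_pos_eq.
      - apply Rmult_le_compat_l; [nra|]. now apply Rinv_le_contravar.
      - apply Rmult_le_pos; [nra|]. left; apply Rinv_0_lt_compat; lra. }
    destruct (step_weight_rate q (S l) hq) as [hw1 hw2].
    (* The first bound rotates at the step weight and uses [IHp]; the second rotates at weight 1,
       where [1 - p] vanishes, and uses [IH1]. *)
    split; eapply wnorm2_rotation_bounds; try exact hT; try assumption;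
      rewrite Rminus_diag, Rabs_R0; lra.
Qed.

Lemma is_grid_le_1 (n : nat) (x : nat -> R) : is_grid n x ->
  forall l : nat, (l <= S n)%nat -> x l <= 1.
Proof.
  intros [_ [h1 hx]] l hl.
  (* The value 1 is known at the right end, so the induction moves leftwards from there. *)
  assert (hdown : forall k, (k <= S n)%nat -> x (S n - k)%nat <= 1).
  { induction k as [|k IH]; intros hk; [rewrite Nat.sub_0_r; lra|].
    specialize (IH ltac:(lia)). specialize (hx (S n - S k)%nat ltac:(lia)).
    replace (S (S n - S k)) with (S n - k)%nat in hx by lia. lra. }
  replace l with (S n - (S n - l))%nat by lia. apply hdown. lia.
Qed.

Theorem proposition5p1 :
  forall cmin cmax : R, 0 < cmin -> cmin <= cmax ->
  forall q : R, -1 < q < 1 ->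
  exists alpha : R, 1 < alpha /\
    forall (n : nat) (x : nat -> R) (c1 c2 omega0 omega : R),
      is_grid n x ->
      cmin <= c1 <= cmax ->
      cmin <= c2 <= cmax ->
      (c2 - c1) / (c2 + c1) = q ->
      0 < omega0 -> omega0 <= omega ->
      forall l : nat, (l <= n)%nat ->
        Cmod (beta0 (wave_speed c1 c2) x omega l) <= Rpower alpha omega /\
        Rpower alpha (- omega) <= Cmod (beta0 (wave_speed c1 c2) x omega l).
Proof.
  intros cmin cmax hc0 _ q hq.
  pose proof (weight_rate_ge2 q) as hK.
  assert (ha : 0 < weight_rate q / cmin) by (apply Rdiv_lt_0_compat; lra).
  (* Since [x l <= 1], the exponent in the bounds on the form is at most
     [omega * (weight_rate q / cmin)]. *)
  exists (exp (weight_rate q / cmin)). split.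
  { rewrite <- exp_0. now apply exp_increasing. }
  intros n x c1 c2 omega0 omega hg [hc1 _] [hc2 _] hqe ho0 ho l hl.
  subst q.
  destruct (wnorm2_beta0_bounds n x cmin c1 c2 omega hg hc0 hc1 hc2 ltac:(lra) hq l hl)
    as [[hlo hup] _].
  set (b := beta0 (wave_speed c1 c2) x omega l) in *.
  set (a := weight_rate ((c2 - c1) / (c2 + c1)) / cmin) in *.
  assert (hT : weight_rate ((c2 - c1) / (c2 + c1)) * (omega * x l / cmin) <= omega * a).
  { replace (weight_rate ((c2 - c1) / (c2 + c1)) * (omega * x l / cmin))
      with (omega * a * x l) by (unfold a; field; lra).
    rewrite <- (Rmult_1_r (omega * a)) at 2.
    apply Rmult_le_compat_l; [|apply (is_grid_le_1 n x hg); lia].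
    apply Rmult_le_pos; lra. }
  assert (hb : wnorm2 1 b = Cmod b * Cmod b).
  { unfold wnorm2, Cmod. rewrite sqrt_sqrt; unfold Re, Im; [ring|].
    apply Rplus_le_le_0_compat; apply pow2_ge_0. }
  unfold Rpower. rewrite ln_exp, Ropp_mult_distr_l_reverse.
  pose proof (Cmod_ge_0 b) as hb0.
  assert (hpos : 0 < omega * a) by (apply Rmult_lt_0_compat; lra).
  assert (Ebig : 1 < exp (omega * a)) by (rewrite <- exp_0; now apply exp_increasing).
  assert (Esmall : exp (- (omega * a)) < 1) by (rewrite <- exp_0; apply exp_increasing; lra).
  pose proof (exp_pos (- (omega * a))).
  assert (hup' : Cmod b * Cmod b <= exp (omega * a))
    by (rewrite <- hb; eapply Rle_trans; [exact hup|]; now apply exp_le).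
  assert (hlo' : exp (- (omega * a)) <= Cmod b * Cmod b)
    by (rewrite <- hb; eapply Rle_trans; [|exact hlo]; apply exp_le; lra).
  (* The form is the squared modulus: [m * m <= E] with [E > 1] forces [m <= E], and [m * m >= e]
     with [0 < e < 1] forces [m >= e]. *)
  split; apply Rnot_lt_le; intros habs; nra.
Qed.
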